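(* Let $G$ be a finite simple graph with $p\ge1$ vertices and $q$ edges, and write $q=tp+t_0$ with $t$ a nonnegative integer and $0\le t_0\le p-1$. Suppose $\lambda(\mathcal{D}[G])=2\lambda(G)$. Then $\mathcal{D}[G]$ is max-$\lambda$ if and only if $G$ is max-$\lambda$ and either $0\le t_0<\frac{p}{4}$ or $\frac{p}{2}\le t_0<\frac{3p}{4}$.
   Context: The total graph $T_2$ is $K_2$ with a loop added at each of its two vertices. The double graph is $\mathcal{D}[G]=G\times T_2$ (Kronecker product): it has vertex set $V(G)\times\{0,1\}$ and $(u,i)$ is adjacent to $(v,j)$ iff $uv\in E(G)$. For a graph $H$ with $p(H)\ge1$ vertices and $q(H)$ edges, $H$ is called max-$\lambda$ if $\lambda(H)=\lfloor 2q(H)/p(H)\rfloor$, where $\lambda$ is edge-connectivity. *)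

(* Defs.v *)
From mathcomp Require Import all_boot.

Set Implicit Arguments.
Unset Strict Implicit.
Unset Printing Implicit Defensive.

(* A graph on the finite vertex type T is given by its adjacency relation     *)
(* e : rel T, assumed symmetric; it is simple when e is moreover irreflexive. *)

(* An edge is the set of its endpoints: doubletons, or singletons for loops.  *)
Definition edges (T : finType) (e : rel T) : {set {set T}} :=
  [set [set xy.1; xy.2] | xy : T * T & e xy.1 xy.2].

Definition num_vertices (T : finType) (e : rel T) : nat := #|T|.
Definition num_edges (T : finType) (e : rel T) : nat := #|edges e|.

Definition del_edges (T : finType) (e : rel T) (F : {set {set T}}) : rel T :=
  [rel x y | e x y && ([set x; y] \notin F)].

Definition connected (T : finType) (e : rel T) : bool :=
  [forall x, forall y, connect e x y].

(* The case #|T| <= 1 is the usual convention that makes the edge             *)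
(* connectivity of the one-vertex graph equal to 0.                           *)
Definition disconnecting (T : finType) (e : rel T) (F : {set {set T}}) : bool :=
  (F \subset edges e) && (~~ connected (del_edges e F) || (#|T| <= 1)).

Definition edge_connectivity (T : finType) (e : rel T) : nat :=
  #|[arg min_(F < edges e | disconnecting e F) #|F|]|.

Definition max_lambda (T : finType) (e : rel T) : Prop :=
  edge_connectivity e = (2 * num_edges e) %/ num_vertices e.

Definition kronecker (T U : finType) (e : rel T) (f : rel U) : rel (T * U) :=
  [rel x y | e x.1 y.1 && f x.2 y.2].

(* K_2 (distinct vertices are adjacent) with a loop added at each vertex.     *)
Definition total_graph2 : rel 'I_2 := [rel i j | (i != j) || (i == j)].

Definition double_graph (T : finType) (e : rel T) : rel (T * 'I_2) :=
  kronecker e total_graph2.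

Lemma double_graphE (T : finType) (e : rel T) (x y : T * 'I_2) :
  double_graph e x y = e x.1 y.1.
Proof.
by rewrite /double_graph /kronecker /total_graph2 /= orNb andbT.
Qed.

Lemma double_graph_sym (T : finType) (e : rel T) :
  symmetric e -> symmetric (double_graph e).
Proof. by move=> se x y; rewrite !double_graphE. Qed.

Lemma double_graph_irr (T : finType) (e : rel T) :
  irreflexive e -> irreflexive (double_graph e).
Proof. by move=> ie x; rewrite double_graphE. Qed.

(* The default value of the arg min is admissible, so edge_connectivity is a  *)
(* genuine minimum.                                                           *)
Lemma disconnecting_edges (T : finType) (e : rel T) :
  disconnecting e (edges e).
Proof.
rewrite /disconnecting subxx /=; case: leqP => [_|T2]; rewrite ?orbT // orbF.
have [x [y [_ _ neq]]] := card_gt1P T2.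
apply/negP => /forallP/(_ x)/forallP/(_ y)/connectP[[|z p] /=].
  by move=> _ yx; rewrite yx eqxx in neq.
case/andP=> /andP[exz nF] _ _; case/negP: nF.
by apply/imsetP; exists (x, z); rewrite ?inE.
Qed.

Lemma edge_connectivityP (T : finType) (e : rel T) :
  (exists2 F, disconnecting e F & #|F| = edge_connectivity e) /\
  (forall F, disconnecting e F -> edge_connectivity e <= #|F|).
Proof.
rewrite /edge_connectivity; case: arg_minnP => [|F dF minF].
  exact: disconnecting_edges.
by split=> //; exists F.
Qed.

(* Main.v *)
Require Import Defs.
From mathcomp Require Import all_boot all_order all_algebra.
From mathcomp Require Import zify.

(** By the handshake lemma D[G] has 4q edges on 2p vertices, so both max-lambda
conditions compare the same number lambda(G) with floors:
2 lambda(G) = floor(4q/p), respectively lambda(G) = floor(2q/p). The first is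
the second together with the parity of floor(4q/p) = 4t + floor(4 t0/p). *)

(** Ordered pairs are easier to count than edges here: on them the Kronecker product acts as a plain
    cartesian product. *)
Definition darts {T : finType} (e : rel T) : {set T * T} :=
  [set xy | e xy.1 xy.2].

Lemma set2_inj {T : finType} (a b x y : T) :
  [set a; b] = [set x; y] -> (a, b) = (x, y) \/ (a, b) = (y, x).
Proof.
move=> E.
have /set2P a_xy : a \in [set x; y] by rewrite -E set21.
have /set2P b_xy : b \in [set x; y] by rewrite -E set22.
have /set2P x_ab : x \in [set a; b] by rewrite E set21.
have /set2P y_ab : y \in [set a; b] by rewrite E set22.
by intuition (subst; auto).
Qed.

(** The map [ends] from darts onto edges has fibres [[set (x, y); (y, x)]], of size exactly 2
    because irreflexivity forces [x != y]. *)
Lemma handshake {T : finType} (e : rel T) :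
  symmetric e -> irreflexive e -> #|darts e| = 2 * num_edges e.
Proof.
move=> e_sym e_irr; pose ends (xy : T * T) := [set xy.1; xy.2].
have edgesE : edges e = ends @: darts e.
  by apply/setP=> F; apply/imsetP/imsetP=> -[xy xyD ->]; exists xy => //;
    rewrite !inE in xyD *.
rewrite /num_edges edgesE -sum1_card (partition_big_imset ends) /= mulnC.
rewrite -sum_nat_const; apply: eq_bigr => _ /imsetP[[x y] + ->].
rewrite inE /= => exy.
have x_neq_y : x != y by apply: contraTneq exy => ->; rewrite e_irr.
rewrite sum1dep_card.
transitivity #|[set (x, y); (y, x)]|; last first.
  by rewrite cards2 xpair_eqE negb_and x_neq_y.
apply: eq_card => -[a b]; rewrite !inE /=.
apply/andP/orP=> [[_ /eqP/set2_inj[] ->]|]; [by left | by right |].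
case=> /eqP[-> ->]; first by rewrite exy.
by rewrite e_sym exy /ends /= setUC.
Qed.

(** A dart of the double graph is a dart of [e] with a free choice of level at each end; [split]
    regroups the coordinates. *)
Lemma card_darts_double {T : finType} (e : rel T) :
  #|darts (double_graph e)| = 4 * #|darts e|.
Proof.
pose split (u : (T * T) * ('I_2 * 'I_2)) := ((u.1.1, u.2.1), (u.1.2, u.2.2)).
have split_inj : injective split by move=> [[? ?] [? ?]] [[? ?] [? ?]] [-> -> -> ->].
have -> : darts (double_graph e) = split @: setX (darts e) setT.
  apply/setP=> -[[x i] [y j]]; rewrite inE double_graphE /=.
  apply/idP/imsetP=> [exy | [[[a b] [k l]] + [-> _ -> _]]].
    by exists ((x, y), (i, j)) => //; rewrite !inE /= exy.
  by rewrite !inE andbT.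
by rewrite card_imset // cardsX cardsT card_prod !card_ord mulnC.
Qed.

Lemma num_edges_double {T : finType} (e : rel T) :
  symmetric e -> irreflexive e -> num_edges (double_graph e) = 4 * num_edges e.
Proof.
move=> e_sym e_irr; have := card_darts_double e.
rewrite !handshake //; first lia.
- exact: double_graph_sym.
- exact: double_graph_irr.
Qed.

(** With [a] and [b] the floors of [2 * t0 / p] and [4 * t0 / p], the two quotients are [2 * t + a]
    and [4 * t + b], and [a] is the floor of [b / 2]. So the left side says that [b] is even and
    [l = 2 * t + a]; the values [b = 0] and [b = 2] give the two ranges of [t0]. *)
Lemma double_eq_divn {l q p t t0 : nat} : q = t * p + t0 -> t0 < p ->
  2 * l = 4 * q %/ p <->
  l = 2 * q %/ p /\ (4 * t0 < p \/ 2 * p <= 4 * t0 < 3 * p).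
Proof.
move=> -> t0p; have p_gt0 : 0 < p by apply: leq_ltn_trans t0p.
rewrite !mulnDr !mulnA !divnMDl //.
have := divn_eq (4 * t0) p; have := ltn_pmod (4 * t0) p_gt0.
have := divn_eq (2 * t0) p; have := ltn_pmod (2 * t0) p_gt0.
move: (2 * t0 %/ p) (2 * t0 %% p) (4 * t0 %/ p) (4 * t0 %% p) => a r b s.
move=> r_lt Ea s_lt Eb.
have a2 : a < 2 by nia.
have b4 : b < 4 by nia.
(* Once [a] and [b] are numerals, the products [a * p] and [b * p] become linear. *)
by move: a b a2 b4 Ea Eb => [|[|//]] [|[|[|[|//]]]] _ _; lia.
Qed.

Local Open Scope ring_scope.
Import Order.TTheory GRing.Theory Num.Theory.

Theorem theorem3p8 (T : finType) (e : rel T) (e_sym : symmetric e)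
    (e_irr : irreflexive e) (p q t t0 : nat)
    (hp : p = num_vertices e) (hq : q = num_edges e)
    (p_ge1 : (1 <= p)%N) (q_div : q = (t * p + t0)%N) (t0_le : (t0 <= p - 1)%N)
    (h_double : edge_connectivity (double_graph e) =
                (2 * edge_connectivity e)%N) :
  max_lambda (double_graph e) <->
    max_lambda e /\
    (0 <= t0%:Q < p%:Q / 4 \/
     p%:Q / 2 <= t0%:Q < 3 * p%:Q / 4).
Proof.
have t0p : (t0 < p)%N by lia.
have p2 : num_vertices (double_graph e) = (2 * p)%N.
  by rewrite hp /num_vertices card_prod card_ord mulnC.
rewrite /max_lambda h_double p2 num_edges_double // -hp -hq divnMl //.
have t0_ge0 : 0 <= t0%:Q by rewrite ler0z.
rewrite t0_ge0 /= !ltr_pdivlMr // ler_pdivrMr //.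
(* With denominators cleared, reading the numerals as casts brings the inequalities from the
   rationals down to [int]. *)
rewrite -[4]/(4%:Q) -[2]/(2%:Q) -[3]/(3%:Q) -!intrM ler_int !ltr_int.
rewrite (double_eq_divn q_div t0p).
by split=> -[-> H]; split=> //; lia.
Qed.
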